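(* Let $f\colon X\to X$ be a continuous map on a compact metric space $X$, and let $\mathcal F_n\colon\mathcal X_n\to2^{\mathcal X_n}$ be a convergent sequence of outer approximations for $f$, where $\mathcal X_n$ are indexing sets of grids on $X$. (1) For every finite sublattice $\mathsf A\subset\mathsf{Att}(X,f)$ there exists $n_{\mathsf A}$ such that for all $n\ge n_{\mathsf A}$ there exists a lattice monomorphism $\ell_n\colon\mathsf A\to\mathsf{ASet}(\mathcal X_n,\mathcal F_n)$ which is a lift of the inclusion $\iota\colon\mathsf A\to\mathsf{Att}(X,f)$ through $\omega(|\cdot|)\colon\mathsf{ASet}(\mathcal X_n,\mathcal F_n)\to\mathsf{Att}(X,f)$, i.e. $\omega(|\ell_n(A)|,f)=A$ for all $A\in\mathsf A$. Furthermore, $\ell_n$ can be chosen such that $|\ell_n(\mathsf A)|=\{|\ell_n(A)|:A\in\mathsf A\}$ is a sublattice of $\mathsf{ANbhd}(X,f)$. (2) Similarly, for every finite sublattice $\mathsf R\subset\mathsf{Rep}(X,f)$ there exists $n_{\mathsf R}$ such that for all $n\ge n_{\mathsf R}$ there exists a lattice monomorphism $\ell_n\colon\mathsf R\to\mathsf{RSet}(\mathcal X_n,\mathcal F_n)$ which is a lift of the inclusion $\mathsf R\to\mathsf{Rep}(X,f)$ through $\alpha(|\cdot|)\colon\mathsf{RSet}(\mathcal X_n,\mathcal F_n)\to\mathsf{Rep}(X,f)$, i.e. $\alpha(|\ell_n(R)|,f)=R$ for all $R\in\mathsf R$; and $\ell_n$ can be chosen such that $|\ell_n(\mathsf R)|$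 is a sublattice of $\mathsf{RNbhd}(X,f)$.
   Context: Lattices: all lattices are bounded and distributive; lattice homomorphisms preserve $0$ and $1$, and sublattices contain $0$ and $1$. A monomorphism is an injective homomorphism. A lift of $g\colon\mathsf L\to\mathsf K$ through $h\colon\mathsf H\to\mathsf K$ is a lattice homomorphism $\ell\colon\mathsf L\to\mathsf H$ with $g=h\circ\ell$. Continuous dynamics: $f$ is not assumed injective or surjective. For $U\subset X$, $\omega(U,f)=\bigcap_{n\ge0}\mathrm{cl}\big(\bigcup_{k\ge n}f^k(U)\big)$ and $\alpha(U,f)=\bigcap_{n\ge0}\mathrm{cl}\big(\bigcup_{k\ge n}f^{-k}(U)\big)$, with $f^{-k}(U)=(f^k)^{-1}(U)$. $U$ is an attracting (repelling) neighborhood if $\omega(U,f)\subset\mathrm{int}(U)$ (resp. $\alpha(U,f)\subset\mathrm{int}(U)$). An attractor is a set of the form $\omega(U,f)$ with $U$ an attracting neighborhood; a repeller is a set of the form $\alpha(U,f)$ with $U$ a repelling neighborhood. $\mathsf{ANbhd}(X,f)$, $\mathsf{RNbhd}(X,f)$ and $\mathsf{Rep}(X,f)$ (attracting neighborhoods, repelling neighborhoods, repellers) are lattices with $\vee=\cup$, $\wedge=\cap$; $\mathsf{Att}(X,f)$ (attractors) is a lattice with $\vee=\cup$ and $A\wedge A'=\omega(A\cap A',f)$, $0=\varnothing$, $1=\omega(X,f)$. Grids: a set $S\subset X$ is regular closed if $S=\mathrm{cl}(\mathrm{int}(S))$. A grid on $X$ is a finite family of nonempty regular closed sets $\{|\xi|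 : \xi\in\mathcal X\}$, indexed by a finite set $\mathcal X$, with $\bigcup_\xi|\xi|=X$ and $|\xi|\cap\mathrm{int}|\xi'|=\varnothing$ for $\xi\ne\xi'$. For $\mathcal U\subset\mathcal X$, $|\mathcal U|=\bigcup_{\xi\in\mathcal U}|\xi|$; $\mathrm{diam}(\mathcal X)=\max_{\xi}\mathrm{diam}(|\xi|)$. Multivalued maps: a combinatorial multivalued map $\mathcal F$ on $\mathcal X$ assigns to each $\xi\in\mathcal X$ a subset $\mathcal F(\xi)\subset\mathcal X$; $\mathcal F(\mathcal U)=\bigcup_{\xi\in\mathcal U}\mathcal F(\xi)$; $\mathcal F^{-1}(\xi)=\{\eta : \xi\in\mathcal F(\eta)\}$; $\mathcal F^n$ is the $n$-fold composition and $\mathcal F^{-n}=(\mathcal F^{-1})^n$. Put $\boldsymbol\omega(\mathcal U)=\bigcap_{k\ge0}\bigcup_{n\ge k}\mathcal F^n(\mathcal U)$ and $\boldsymbol\alpha(\mathcal U)=\bigcap_{k\le0}\bigcup_{n\le k}\mathcal F^n(\mathcal U)$. $\mathsf{ASet}(\mathcal X,\mathcal F)=\{\mathcal U\subset\mathcal X:\boldsymbol\omega(\mathcal U)\subset\mathcal U\}$ and $\mathsf{RSet}(\mathcal X,\mathcal F)=\{\mathcal U\subset\mathcal X:\boldsymbol\alpha(\mathcal U)\subset\mathcal U\}$, lattices under $\cup,\cap$. $\mathcal F$ is an outer approximation of $f$ if $f(|\xi|)\subset\mathrm{int}|\mathcal F(\xi)|$ for all $\xi\in\mathcal X$. Convergence: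 for $\rho\ge0$ the $\rho$-minimal map on $\mathcal X$ is $\mathcal F_\rho(\xi)=\{\eta\in\mathcal X : B_\rho(f(|\xi|))\cap|\eta|\ne\varnothing\}$, where $B_\rho(S)$ is the $\rho$-neighborhood of $S$ and $B_0(S)=S$; the minimal map is $\mathcal F_{\mathrm o}(\xi)=\{\eta : f(|\xi|)\cap|\eta|\neq\varnothing\}$. A sequence of outer approximations $\mathcal F_n$ on $\mathcal X_n$ converges if $\mathrm{diam}(\mathcal X_n)\to0$ and there are $\rho_n\to0$ such that $\mathcal F_{\mathrm o,n}(\xi)\subset\mathcal F_n(\xi)\subset\mathcal F_{\rho_n}(\xi)$ for all $\xi\in\mathcal X_n$ and all $n$ (minimal and $\rho_n$-minimal maps on $\mathcal X_n$). *)

(* Defs.v *)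
From HB Require Import structures.
From mathcomp Require Import all_boot all_order all_algebra.
From mathcomp Require Import all_classical all_reals all_analysis.

Set Implicit Arguments.
Unset Strict Implicit.
Unset Printing Implicit Defensive.

Import Order.TTheory GRing.Theory Num.Theory.
Import numFieldNormedType.Exports.

Local Open Scope classical_set_scope.
Local Open Scope ring_scope.

(* A bounded lattice is presented by its carrier, a set in some type T, and its
   operations, given as total functions on T and meaningful on the carrier.
   (The meet of attractors is not the meet of the powerset order, so that the
   lattices below are not all sublattices of a powerset lattice.) *)
Record lattice_on (T : Type) := LatticeOn {
  lcarrier : set T;
  ljoin : T -> T -> T;
  lmeet : T -> T -> T;
  lbot : T;
  ltop : T
}.

Definition is_sublattice (T : Type) (S : set T) (L : lattice_on T) : Prop :=
  [/\ S `<=` lcarrier L, S (lbot L), S (ltop L),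
      (forall x y, S x -> S y -> S (ljoin L x y)) &
      (forall x y, S x -> S y -> S (lmeet L x y))].

Definition restrict_lattice (T : Type) (S : set T) (L : lattice_on T) :
    lattice_on T :=
  LatticeOn S (ljoin L) (lmeet L) (lbot L) (ltop L).

Definition lattice_hom (T U : Type) (L : lattice_on T) (M : lattice_on U)
    (h : T -> U) : Prop :=
  [/\ (forall x, lcarrier L x -> lcarrier M (h x)), h (lbot L) = lbot M, h (ltop L) = ltop M,
      (forall x y, lcarrier L x -> lcarrier L y ->
         h (ljoin L x y) = ljoin M (h x) (h y)) &
      (forall x y, lcarrier L x -> lcarrier L y ->
         h (lmeet L x y) = lmeet M (h x) (h y))].

Definition lattice_mono (T U : Type) (L : lattice_on T) (M : lattice_on U)
    (h : T -> U) : Prop :=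
  lattice_hom L M h /\ set_inj (lcarrier L) h.

(* l : L -> H is a lift of g : L -> K through h : H -> K. *)
Definition is_lift (T U V : Type) (L : lattice_on T) (H : lattice_on U)
    (g : T -> V) (h : U -> V) (l : T -> U) : Prop :=
  lattice_hom L H l /\ (forall x, lcarrier L x -> g x = h (l x)).

Section Dynamics.
Context {X : topologicalType} (f : X -> X).
Implicit Types U : set X.

Definition omega_lim U : set X :=
  \bigcap_n closure (\bigcup_(k >= n) (iter k f @` U)).

Definition alpha_lim U : set X :=
  \bigcap_n closure (\bigcup_(k >= n) (iter k f @^-1` U)).

Definition attracting_nbhd U : Prop := omega_lim U `<=` U°.

Definition repelling_nbhd U : Prop := alpha_lim U `<=` U°.

Definition attractor (A : set X) : Prop :=
  exists2 U, attracting_nbhd U & A = omega_lim U.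

Definition repeller (A : set X) : Prop :=
  exists2 U, repelling_nbhd U & A = alpha_lim U.

Definition ANbhd : lattice_on (set X) :=
  LatticeOn attracting_nbhd setU setI set0 setT.

Definition RNbhd : lattice_on (set X) :=
  LatticeOn repelling_nbhd setU setI set0 setT.

Definition Att : lattice_on (set X) :=
  LatticeOn attractor setU (fun A B => omega_lim (A `&` B))
    set0 (omega_lim setT).

Definition Rep : lattice_on (set X) :=
  LatticeOn repeller setU setI set0 setT.

End Dynamics.

Section Multivalued.
Context {I : finType}.
Implicit Types (F : I -> {set I}) (U : {set I}).

Definition mv_image F U : {set I} := (\bigcup_(i in U) F i)%SET.

Definition mv_inverse F : I -> {set I} := fun i => [set j | i \in F j]%SET.

Definition mv_pow F (n : nat) U : {set I} := iter n (mv_image F) U.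

Definition mv_omega F U : set I :=
  \bigcap_k \bigcup_(n >= k) [set` mv_pow F n U].

(* The index n >= 0 stands for the power - n, F^{-n} being (F^{-1})^n. *)
Definition mv_alpha F U : set I :=
  \bigcap_k \bigcup_(n >= k) [set` mv_pow (mv_inverse F) n U].

Definition ASet F : lattice_on {set I} :=
  LatticeOn [set U | mv_omega F U `<=` [set` U]]
    (@finset.setU I) (@finset.setI I) finset.set0 [set: I]%SET.

Definition RSet F : lattice_on {set I} :=
  LatticeOn [set U | mv_alpha F U `<=` [set` U]]
    (@finset.setU I) (@finset.setI I) finset.set0 [set: I]%SET.

End Multivalued.

(* The family G : I -> set X sends an index xi to the set |xi|. *)
Definition grid (X : topologicalType) (I : finType) (G : I -> set X) : Prop :=
  [/\ forall i, G i !=set0,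
      forall i, regclosed (G i),
      \bigcup_i G i = setT &
      forall i j, i != j -> G i `&` (G j)° = set0].

Definition realize (X : Type) (I : finType) (G : I -> set X) (U : {set I}) :
    set X :=
  \bigcup_(i in [set` U]) G i.

Definition outer_approximation (X : topologicalType) (f : X -> X)
    (I : finType) (G : I -> set X) (F : I -> {set I}) : Prop :=
  forall i, f @` G i `<=` (realize G (F i))°.

Section Convergence.
Context {R : realType} {X : metricType R}.

Definition diam (S : set X) : R :=
  sup [set mdist p.1 p.2 | p in S `*` S].

Definition grid_diam (I : finType) (G : I -> set X) : R :=
  \big[Num.max/0]_(i : I) diam (G i).

Definition metric_nbhd (rho : R) (S : set X) : set X :=
  if rho == 0 then S else [set y | exists2 x, S x & mdist x y < rho].

Definition rho_minimal_map (f : X -> X) (I : finType) (G : I -> set X)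
    (rho : R) (i : I) : {set I} :=
  [set j | `[< metric_nbhd rho (f @` G i) `&` G j !=set0 >]]%SET.

Definition minimal_map (f : X -> X) (I : finType) (G : I -> set X) (i : I) :
    {set I} :=
  [set j | `[< f @` G i `&` G j !=set0 >]]%SET.

Definition convergent (f : X -> X) (I : nat -> finType)
    (G : forall n, I n -> set X) (F : forall n, I n -> {set I n}) : Prop :=
  (grid_diam (G n) @[n --> \oo] --> (0 : R)) /\
  exists rho : nat -> R,
    [/\ forall n, 0 <= rho n,
        rho n @[n --> \oo] --> (0 : R) &
        forall n i,
          minimal_map f (G n) i \subset F n i /\
          F n i \subset rho_minimal_map f (G n) (rho n) i].

End Convergence.

(* Main.v *)
Require Import Defs.
From mathcomp Require Import all_boot all_order all_algebra.
From mathcomp Require Import all_classical all_reals all_analysis.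
From mathcomp Require Import lra zify.

Set Implicit Arguments.
Unset Strict Implicit.
Unset Printing Implicit Defensive.

Import Order.TTheory GRing.Theory Num.Theory.
Import numFieldNormedType.Exports.

Local Open Scope classical_set_scope.

(** Every lift is produced by a single device: a map [z] from the cells of the
    grid to points of [X].  If [O] turns the operations of a lattice of sets
    into unions and intersections, then [A |-> {i | z i \in O A}] is a lattice
    homomorphism for free, as an inverse image under [z] ([label_set]).  For
    repellers [O] is the identity; for attractors, whose meet is not the
    intersection, [O A] is the basin of [A], the complement of the dual
    repeller.

    Two things are then asked of [z].  Call [K j] the finitely many closed
    sets involved (the repellers, or the complements of the basins).
    - [z i] is close to the cell [i], and lies in every [K j] that comes close
      to the cell.  Hence the realization of the cell set of an attractor [A]
      contains a neighborhood of [A] and stays away from the dual repeller of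
      [A]; the realization of the cell set of a repeller [B] lies between two
      thin neighborhoods of [B].
    - Cells that share a point have labels [z i], [z j] such that one of them
      belongs to every [K k] that contains the other.  This makes realizations
      commute with intersections: a point common to a cell of the first family
      and a cell of the second lies in a cell of both.
    Such a [z] exists ([comparable_labels]): take scales [s 0 > s 1 > ...], each
    so small with respect to the previous one that sets which come
    [s (i.+1)]-close to a point share a point at distance less than [s i].  By
    the pigeonhole principle each point [x] has a scale at which passing from
    [s i] to [s (i.+1)] loses none of the [K j] near [x]; a common point of
    these [K j] at distance less than [s i] then lies in no other [K j].
    Neighboring points see comparable families, the one with the coarser scale
    seeing more.

    It remains to see that all large [n] are good for all cell sets between the
    two bounds ([attractor_cells], [repeller_cells]).  The limit set of the
    realization is computed in [X] alone.  For the combinatorial limit, orbits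
    of [F n] are pseudo-orbits of [f] with errors tending to zero, so they
    follow true orbits up to any given time ([shadow]).  If [f] brings the outer
    bound close to [A] at all times from [L] on, then for large [n] the orbits
    of [F n] lie in the inner bound at the times between [L] and [2 L].
    Restarting the argument at time [L] propagates this to all times
    ([mv_pow_trapped]), so finite-time shadowing suffices.  Repellers are
    treated in the same way along backward orbits. *)

Local Open Scope ring_scope.

(** * Uniformity on compact metric spaces *)

Section CompactMetric.
Context {R : realType} {X : metricType R}.
Hypothesis X_compact : compact [set: X].
Implicit Types (x y z : X) (r e : R) (K V : set X).

Lemma nbhs_mdist x V :
  nbhs x V <-> exists2 r, 0 < r & forall y, mdist x y < r -> V y.
Proof. exact: metricType_numDomainType.nbhs_mdistP. Qed.

(** Compactness in the form used for uniform estimates: a property that gets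
    easier as the radius shrinks and that holds locally with some radius holds
    everywhere with one radius. *)
Lemma compact_uniform_radius (P : R -> X -> Prop) :
  (forall r s y, r <= s -> P s y -> P r y) ->
  (forall x, exists2 r, 0 < r & forall y, mdist x y < r -> P r y) ->
  exists2 r, 0 < r & forall y, P r y.
Proof.
move=> P_anti P_loc.
have /(_ R (0^'+) P _) : near_covering [set: X] by exact/compact_near_coveringP.
case=> [x _|r /= r0 rP].
  have [r r0 rP] := P_loc x.
  exists ([set y | mdist x y < r], [set e | e < r]) => /=.
    by split; [apply/nbhs_mdist; exists r|exact: nbhs_right_lt].
  by move=> [y e] /= [xy er]; apply: P_anti (ltW er) (rP _ xy).
exists (r / 2); first by rewrite divr_gt0.
move=> y; apply: rP => //=; last by rewrite divr_gt0.
by rewrite sub0r normrN gtr0_norm ?divr_gt0// ltr_pdivrMr// ltr_pMr// ltr1n.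
Qed.

(** The analogue for properties that hold at all large times. *)
Lemma compact_uniform_time (P : nat -> X -> Prop) :
  (forall x, exists2 r, 0 < r &
     exists N, forall y, mdist x y < r -> forall k, (N <= k)%N -> P k y) ->
  exists N, forall k, (N <= k)%N -> forall y, P k y.
Proof.
move=> P_loc.
have /(_ nat \oo P _) : near_covering [set: X] by exact/compact_near_coveringP.
case=> [x _|N _ NP].
  have [r r0 [N rP]] := P_loc x.
  exists ([set y | mdist x y < r], [set k | (N <= k)%N]) => /=.
    by split; [apply/nbhs_mdist; exists r|exact: nbhs_infty_ge].
  by move=> [y k] /= [xy Nk]; exact: rP.
by exists N => k Nk y; exact: NP.
Qed.

Lemma closed_far K x : closed K -> ~ K x ->
  exists2 r, 0 < r & forall y, K y -> ~ mdist x y < r.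
Proof.
move=> Kc nKx.
have /nbhs_mdist[r r0 rK] := open_nbhs_nbhs (conj (closed_openC Kc) nKx).
by exists r => // y Ky /rK.
Qed.

Definition thickening K r : set X := [set x | exists2 k, K k & mdist k x < r].

Lemma sub_interior_thickening K r : 0 < r -> K `<=` (thickening K r)°.
Proof. by move=> r0 k Kk; apply/nbhs_mdist; exists r => // x kx; exists k. Qed.

Lemma closed_sub_open_uniform K V : closed K -> open V -> K `<=` V ->
  exists2 r, 0 < r & forall x y, K x -> mdist x y < r -> V y.
Proof.
move=> Kc Vo KV.
have [|x|r r0 rP] := @compact_uniform_radius
    (fun r x => K x -> forall y, mdist x y < r -> V y); last first.
- by exists r => // x y Kx; exact: rP.
- have [Vx|nVx] := pselect (V x).
    have /nbhs_mdist[r r0 rV] := open_nbhs_nbhs (conj Vo Vx).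
    exists (r / 2); first by rewrite divr_gt0.
    move=> y xy _ z yz; apply: rV.
    by have := metric_triangle x y z; lra.
  have [r r0 rK] := closed_far Kc (contra_not (@KV x) nVx).
  by exists r => // y xy Ky; case: (rK y Ky xy).
- by move=> r s y rs sP Ky z yz; apply: sP => //; exact: lt_le_trans yz rs.
Qed.

Lemma compact_uniform_continuity (g : X -> X) e : continuous g -> 0 < e ->
  exists2 r, 0 < r & forall x y, mdist x y < r -> mdist (g x) (g y) < e.
Proof.
move=> gc e0.
have [||r r0 rP] := @compact_uniform_radius
    (fun r x => forall y, mdist x y < r -> mdist (g x) (g y) < e); last first.
- by exists r.
- move=> x.
  have /nbhs_mdist[r r0 rg] : nbhs x (g @^-1` [set z | mdist (g x) z < e / 2]).
    by apply: gc; apply/nbhs_mdist; exists (e / 2) => //; rewrite divr_gt0.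
  exists (r / 2); first by rewrite divr_gt0.
  move=> y xy z yz.
  have /= gy := rg y ltac:(lra).
  have /= gz := rg z ltac:(have := metric_triangle x y z; lra).
  have := metric_triangle (g y) (g x) (g z).
  by rewrite (metric_sym (g y) (g x)); lra.
- by move=> r s x rs sP y xy; apply: sP; exact: lt_le_trans xy rs.
Qed.

Lemma compact_mdist_bounded x : exists M : R, forall y, mdist x y < M.
Proof.
have [|N /(_ N (leqnn _)) NP] := @compact_uniform_time
  (fun k y => mdist x y < k%:R); last by exists N%:R.
move=> y; exists 1 => //.
exists (Num.bound (mdist x y + 1)) => z yz k Nk.
have : (Num.bound (mdist x y + 1))%:R <= k%:R :> R by rewrite ler_nat.
have := archi_boundP (_ : 0 <= mdist x y + 1).
rewrite addr_ge0 ?mdist_ge0// => /(_ isT).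
have := metric_triangle x y z.
by lra.
Qed.

(** Both [omega_lim] and [alpha_lim] have this form, for the forward and the
    inverse images of a set. *)
Lemma limsup_sub_open (T : nat -> set X) V : open V ->
  \bigcap_n closure (\bigcup_(k >= n) T k) `<=` V ->
  exists N, forall k, (N <= k)%N -> T k `<=` V.
Proof.
move=> Vo TV; apply: (@compact_uniform_time (fun k y => T k y -> V y)) => x.
have [Vx|nVx] := pselect (V x).
  have /nbhs_mdist[r r0 rV] := open_nbhs_nbhs (conj Vo Vx).
  by exists r => //; exists 0%N => y xy k _ _; exact: rV.
have /existsNP[n /not_implyP[_ nx]] :
    ~ (\bigcap_n closure (\bigcup_(k >= n) T k)) x.
  by move=> /TV.
move/existsNP: nx => [W /not_implyP[/nbhs_mdist[r r0 rW]]] WT.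
exists r => //; exists n => y xy k nk Ty; exfalso; apply: WT.
by exists y; split; [exists k|exact: rW].
Qed.

(** * Labels with comparable memberships *)

Section Labelling.
Context {J : finType} (K : J -> set X) (K_closed : forall j, closed (K j)).

Definition near_member r x (j : J) : Prop := exists2 k, K j k & mdist x k < r.

Lemma near_member_le r s x j : r <= s -> near_member r x j -> near_member s x j.
Proof. by move=> rs [k Kk xk]; exists k => //; exact: lt_le_trans xk rs. Qed.

Lemma near_member_shift r s x y j :
  near_member r y j -> mdist x y < s -> near_member (r + s) x j.
Proof.
by move=> [k Kk yk] xy; exists k => //; have := metric_triangle x y k; lra.
Qed.

(** A cover by balls centered at points [x], each missing all the [K j] that
    do not contain [x], has a Lebesgue number.  The center of a ball containing
    the given point is then the common point. *)
Lemma common_point e : 0 < e -> exists2 r, 0 < r <= e / 2 &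
  forall x, exists2 z, mdist x z < e & forall j, near_member r x j -> K j z.
Proof.
move=> e0; have [||r r0 rP] := @compact_uniform_radius (fun r x =>
    exists2 z, mdist x z < e & forall j, near_member r x j -> K j z); last first.
- exists (Num.min r (e / 2)).
    by rewrite lt_min r0 divr_gt0//= ge_min lexx orbT.
  move=> x; have [z xz zP] := rP x; exists z => // j xj; apply: zP.
  by apply: near_member_le xj; rewrite ge_min lexx.
- move=> x.
  have /choice[rho rhoP] : forall j, exists r,
      0 < r /\ (near_member r x j -> K j x).
    move=> j; have [Kx|nKx] := pselect (K j x); first by exists 1.
    have [r r0 rK] := closed_far (@K_closed j) nKx.
    by exists r; split => // -[k /rK].
  pose r := \big[Num.min/e]_j rho j.
  have r0 : 0 < r by apply: lt_bigmin => // j _; case: (rhoP j).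
  exists (r / 2); first by rewrite divr_gt0.
  move=> y xy; exists x.
    have : r <= e by exact: bigmin_le_id.
    by rewrite metric_sym; lra.
  move=> j yj; case: (rhoP j) => _; apply.
  have : r <= rho j by exact: bigmin_le.
  by move=> rr; apply: near_member_le (near_member_shift yj xy); lra.
- move=> r s x rs [z xz zP]; exists z => // j xj; apply: zP.
  exact: near_member_le xj.
Qed.

(** A decreasing chain of subsets of [J] cannot be strict for more than [#|J|]
    steps. *)
Lemma stationary_step (T : nat -> {set J}) :
  (forall i, T i.+1 \subset T i) ->
  exists2 i, (i <= #|J|)%N & T i.+1 = T i.
Proof.
move=> T_dec; apply: contrapT => T_neq.
have T_card i : (i <= #|J|.+1)%N -> (#|T i| + i <= #|J|)%N.
  elim: i => [_|i IH iJ]; first by rewrite addn0 max_card.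
  have : (#|T i.+1| < #|T i|)%N.
    apply: proper_card; rewrite finset.properEneq T_dec andbT.
    by apply/eqP => Ti; apply: T_neq; exists i.
  by have := IH (ltnW iJ); lia.
by have := T_card _ (leqnn _); lia.
Qed.

(** [z x] is a point of exactly those [K j] that are near [x] at a scale at
    which this family is stationary.  The third clause compares two such
    families: if the scale of [y] is the finer one, the sets near [y] at the
    scale after it are near [x] at the scale of [x]. *)
Lemma comparable_labels e : 0 < e ->
  exists2 r, 0 < r &
  exists z : X -> X,
  [/\ forall x, mdist x (z x) < e,
      forall x j, near_member r x j -> K j (z x) &
      forall x y, mdist x y < r ->
        (forall j, K j (z x) -> K j (z y)) \/
        (forall j, K j (z y) -> K j (z x))].
Proof.
move=> e0.
have /choice[m mP] : forall e, exists r, 0 < e -> 0 < r <= e / 2 /\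
    forall x, exists2 z, mdist x z < e & forall j, near_member r x j -> K j z.
  move=> s; have [s0|_] := boolP (0 < s); last by exists 0.
  by have [r r0 rP] := common_point s0; exists r.
pose s i := iter i m e.
have s0 i : 0 < s i.
  by elim: i => [//|i IH] /=; have [/andP[]] := mP _ IH.
have s_half i : s i.+1 <= s i / 2 by have [/andP[]] := mP _ (s0 i).
have s_dec i k : (i <= k)%N -> s k <= s i.
  move=> /subnK <-; elim: (k - i)%N => [//|l IH].
  by have := s_half (l + i)%N; have := s0 (l + i)%N; rewrite addSn; lra.
pose T x i := [set j | `[< near_member (s i) x j >]]%SET.
have TP x i j : (j \in T x i) <-> near_member (s i) x j.
  by rewrite inE; split => /asboolP.
have /choice[c cP] : forall x, exists i, (i <= #|J|)%N /\ T x i.+1 = T x i.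
  move=> x; have [i|i] := @stationary_step (T x); last by exists i.
  apply/fintype.subsetP => j /TP xj; apply/TP.
  by apply: near_member_le xj; exact: s_dec.
have /choice[z zP] : forall x, exists z, mdist x z < s (c x) /\
    forall j, near_member (s (c x).+1) x j -> K j z.
  by move=> x; have [_ /(_ x)[z]] := mP _ (s0 (c x)); exists z.
(* A [K j] through [z x] is within [s (c x)] of [x], hence also within
   [s (c x).+1] by stationarity. *)
have zE x j : K j (z x) <-> j \in T x (c x).
  split=> [Kz|]; first by apply/TP; exists (z x) => //; case: (zP x).
  by case: (cP x) => _ <- /TP; case: (zP x) => _; apply.
(* Indices [c y] are at most [#|J|], which bounds the room [s (c y).+1] left by
   halving from below by [s #|J|.+1]. *)
have z_mono x y : mdist x y < s #|J|.+1 -> (c x <= c y)%N ->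
    forall j, K j (z y) -> K j (z x).
  move=> xy cxy j /zE; have [cJ <-] := cP y => /TP yj; apply/zE/TP.
  apply: near_member_le (near_member_shift yj xy).
  have := s_dec _ _ cxy; have := s_half (c y).
  have : s #|J|.+1 <= s (c y).+1 by exact: s_dec.
  by lra.
exists (s #|J|.+1) => //; exists z; split.
- move=> x; case: (zP x) => + _ => /lt_le_trans; apply.
  exact: (s_dec 0%N).
- move=> x j xj; case: (zP x) => _; apply; apply: near_member_le xj.
  by apply: s_dec; rewrite ltnS; case: (cP x).
- move=> x y xy; have [cxy|/ltnW cyx] := leqP (c x) (c y).
    by right; exact: z_mono.
  by left; apply: z_mono => //; rewrite metric_sym.
Qed.

End Labelling.
End CompactMetric.

(** * Iterates of multivalued maps *)

Section MultivaluedIterates.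
Context {I : finType}.
Implicit Types (H : I -> {set I}) (U V C E : {set I}).

Lemma mv_powD H m n U : mv_pow H (m + n) U = mv_pow H m (mv_pow H n U).
Proof. exact: iterD. Qed.

Lemma mv_powP H k U j :
  reflect (exists2 i, i \in U & j \in mv_pow H k [set i]%SET)
          (j \in mv_pow H k U).
Proof.
apply: (iffP idP).
  elim: k j => [|k IH] j; first by move=> jU; exists j => //; rewrite inE.
  rewrite /mv_pow iterS => /bigcupP[l /IH[i iU li] jl].
  by exists i => //; rewrite iterS; apply/bigcupP; exists l.
elim: k j => [|k IH] j [i iU]; first by rewrite inE => /eqP ->.
rewrite /mv_pow iterS => /bigcupP[l li jl].
by rewrite iterS; apply/bigcupP; exists l => //; apply: IH; exists i.
Qed.

Lemma mv_pow_subset H k U V : U \subset V -> mv_pow H k U \subset mv_pow H k V.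
Proof.
move=> /fintype.subsetP UV; apply/fintype.subsetP => j /mv_powP[i /UV iV ij].
by apply/mv_powP; exists i.
Qed.

Lemma mem_mv_pow_inverse H k i j :
  (j \in mv_pow (mv_inverse H) k [set i]%SET) = (i \in mv_pow H k [set j]%SET).
Proof.
elim: k j => [|k IH] j; first by rewrite !inE eq_sym.
have H1 : mv_image H [set j]%SET = H j by exact: finset.big_set1.
rewrite /mv_pow iterS iterSr H1.
apply/bigcupP/mv_powP => -[l li lj]; exists l.
- by move: lj; rewrite inE.
- by rewrite -IH.
- by rewrite [_ \in _]IH.
- by rewrite inE.
Qed.

(** Any [k >= L] is reached in steps of length [L], each of which ends in
    [E \subset C], followed by a last step of length less than [2 L]. *)
Lemma mv_pow_trapped H L C E : (0 < L)%N -> E \subset C ->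
  (forall k, (L <= k < L + L)%N -> mv_pow H k C \subset E) ->
  forall k, (L <= k)%N -> mv_pow H k C \subset E.
Proof.
move=> L0 EC CE k; have [m] := ubnP k; elim: m k => // m IH k km Lk.
have [kLL|LLk] := ltnP k (L + L); first by apply: CE; rewrite Lk.
rewrite -(subnK Lk) mv_powD.
apply: (fintype.subset_trans (mv_pow_subset _ _ _)); last first.
  by apply: (IH (k - L)%N); lia.
by apply: (fintype.subset_trans _ EC); apply: CE; lia.
Qed.

(** Stated for any map [H], to serve for [mv_omega] and, with the inverse map,
    for [mv_alpha]. *)
Lemma mv_limit_trapped H L C E V : (0 < L)%N -> E \subset V -> V \subset C ->
  (forall k, (L <= k < L + L)%N -> mv_pow H k C \subset E) ->
  \bigcap_k \bigcup_(n >= k) [set` mv_pow H n V] `<=` [set` V].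
Proof.
move=> L0 EV VC CE j /(_ L Logic.I)[k /= Lk jk].
apply: (fintype.subsetP EV).
apply: (fintype.subsetP (mv_pow_trapped L0 (fintype.subset_trans EV VC) CE Lk)).
exact: (fintype.subsetP (mv_pow_subset _ _ VC)).
Qed.

End MultivaluedIterates.

(** * Limit sets and basins *)

Section Limits.
Context {X : topologicalType} (f : X -> X).
Implicit Types (U V A B : set X).

Lemma iter_continuous k : continuous f -> continuous (iter k f).
Proof.
move=> f_cont; elim: k => [|k IH] x; first exact: cvg_id.
exact: (continuous_comp (IH x) (f_cont _)).
Qed.

(** Dropping the first [m] iterates does not change a limit set; besides
    monotonicity ([m = 0]), this gives lower bounds for limit sets. *)
Lemma omega_lim_sub m U V :
  iter m f @` U `<=` V -> omega_lim f U `<=` omega_lim f V.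
Proof.
move=> UV x Ux n _; have := Ux (n + m)%N I; apply: closure_subset.
move=> y [k /= nmk [u Uu <-]]; exists (k - m)%N; first by rewrite /=; lia.
exists (iter m f u); first by apply: UV; exists u.
by rewrite -iterD subnK//; lia.
Qed.

Lemma alpha_lim_sub m U V :
  iter m f @^-1` U `<=` V -> alpha_lim f U `<=` alpha_lim f V.
Proof.
move=> UV x Ux n _; have := Ux (n + m)%N I; apply: closure_subset.
move=> y [k /= nmk Uu]; exists (k - m)%N; first by rewrite /=; lia.
by apply: UV; rewrite /= -iterD subnKC//; lia.
Qed.

Lemma omega_lim_closed U : closed (omega_lim f U).
Proof. by apply: closed_bigI => n _; exact: closed_closure. Qed.

Lemma alpha_lim_closed U : closed (alpha_lim f U).
Proof. by apply: closed_bigI => n _; exact: closed_closure. Qed.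

(** The complement of the dual repeller of [A], when [A] is an attractor. *)
Definition basin A : set X := [set x | omega_lim f [set x] `<=` A].

Lemma basin_of_entry U k x : U (iter k f x) -> basin (omega_lim f U) x.
Proof. by move=> Ux; apply: (@omega_lim_sub k) => y [_ -> <-]. Qed.

End Limits.

Section Basins.
Context {R : realType} {X : metricType R} (f : X -> X).
Hypotheses (X_compact : compact [set: X]) (f_cont : continuous f).
Implicit Types (U V A B : set X).

Lemma eventually_in A V x : open V -> A `<=` V -> basin f A x ->
  exists N, forall k, (N <= k)%N -> V (iter k f x).
Proof.
move=> Vo AV Ax.
have [|N NP] := limsup_sub_open X_compact Vo
  (_ : omega_lim f [set x] `<=` V).
  exact: subset_trans Ax AV.
by exists N => k Nk; apply: (NP k Nk); exists x.
Qed.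

(** With [basin_of_entry]: a point lies in the basin exactly when its orbit
    enters an attracting neighborhood.  The basin is thus open, and turns unions
    of attractors into unions. *)
Lemma basin_entry U x : attracting_nbhd f U -> basin f (omega_lim f U) x ->
  exists k, U° (iter k f x).
Proof.
move=> UU /(eventually_in (@open_interior _ U) UU)[N NP].
by exists N; exact: NP.
Qed.

Lemma attractor_sub_basin A : attractor f A -> A `<=` basin f A.
Proof.
move=> [U UU ->] x /UU /interior_subset Ux; exact: (@basin_of_entry _ _ _ 0).
Qed.

Lemma basin_open A : attractor f A -> open (basin f A).
Proof.
move=> [U UU ->]; rewrite openE => x /(basin_entry UU)[k Ux].
have : nbhs x (iter k f @^-1` U°).
  apply: (iter_continuous f_cont).
  exact: open_nbhs_nbhs (conj (@open_interior _ U) Ux).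
by apply: filterS => y /= /interior_subset; exact: basin_of_entry.
Qed.

Lemma basin_set0 : basin f set0 = set0.
Proof.
apply/seteqP; split => // x x0; have [//|N NP] := eventually_in open0 _ x0.
by have := NP N (leqnn _).
Qed.

Lemma basin_omega_setT : basin f (omega_lim f [set: X]) = [set: X].
Proof. by apply/seteqP; split => // x _; exact: (@basin_of_entry _ _ _ 0). Qed.

Lemma basin_setU A B : attractor f A -> attractor f B ->
  basin f (A `|` B) = basin f A `|` basin f B.
Proof.
move=> [U UU ->] [V VV ->]; apply/seteqP; split => x; last first.
  by move=> -[] xP y /xP; [left|right].
move=> /(@eventually_in _ (U° `|` V°)) [||N /(_ N (leqnn _))].
- by apply: openU; exact: open_interior.
- by move=> y [/UU|/VV]; [left|right].
- by move=> -[] /interior_subset /basin_of_entry; [left|right].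
Qed.

(** An orbit attracted by [A] and by [B] accumulates in [A `&` B] only, and
    points near [A `&` B] are brought by an iterate of [f] into an attracting
    neighborhood of the limit set of [A `&` B]. *)
Lemma basin_meet A B : attractor f A -> attractor f B ->
  attractor f (omega_lim f (A `&` B)) ->
  basin f (omega_lim f (A `&` B)) = basin f A `&` basin f B.
Proof.
move=> [U UU AE] [V VV BE] [W WW CE]; apply/seteqP; split => x.
  move=> xC; split => y /xC.
    rewrite {2}AE; apply: (@omega_lim_sub _ _ 0) => _ [z [Az _] <-].
    by apply: interior_subset; apply: UU; rewrite -AE.
  rewrite {2}BE; apply: (@omega_lim_sub _ _ 0) => _ [z [_ Bz] <-].
  by apply: interior_subset; apply: VV; rewrite -BE.
move=> [xA xB]; rewrite CE.
have [|m mP] := limsup_sub_open X_compact (@open_interior _ W)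
  (_ : omega_lim f (A `&` B) `<=` W°).
  by rewrite CE.
have Wo : open (iter m f @^-1` W°).
  apply: open_comp; last exact: open_interior.
  by move=> y _; exact: iter_continuous.
have [||k kP] := @eventually_in (A `&` B) _ x Wo.
- by move=> y ABy; apply: (mP m) => //; exists y.
- by move=> y xy; split; [exact: xA|exact: xB].
apply: (@basin_of_entry _ _ _ (m + k)); rewrite iterD.
by apply: interior_subset; exact: (kP k).
Qed.

(** Points at distance at least [r] from the dual repeller form a compact subset
    of the basin, which is attracted uniformly. *)
Lemma uniform_attraction A V r : attractor f A -> open V -> A `<=` V -> 0 < r ->
  exists N, forall k, (N <= k)%N ->
    forall x, (forall y, ~ basin f A y -> r <= mdist x y) -> V (iter k f x).
Proof.
move=> Aa Vo AV r0; apply: (@compact_uniform_time _ _ X_compact (fun k x =>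
  (forall y, ~ basin f A y -> r <= mdist x y) -> V (iter k f x))) => x.
have [xA|nxA] := pselect (basin f A x); last first.
  exists r => //; exists 0%N => y xy k _ /(_ _ nxA).
  by rewrite metric_sym; lra.
have [U UU AE] := Aa; rewrite AE in xA.
have [k Ux] := basin_entry UU xA.
have : nbhs x (iter k f @^-1` U°).
  apply: (iter_continuous f_cont).
  exact: open_nbhs_nbhs (conj (@open_interior _ U) Ux).
move=> /nbhs_mdist[s s0 sP].
have [|N NP] := limsup_sub_open X_compact Vo (_ : omega_lim f U `<=` V).
  by rewrite -AE.
exists s => //; exists (N + k)%N => y /sP Uy l Nl _.
apply: (NP (l - k)%N); first by lia.
exists (iter k f y); first exact: interior_subset.
by rewrite -iterD subnK//; lia.
Qed.

End Basins.

(** * Lattices of cells defined by labels *)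

Section Realization.
Context {X : Type} {I : finType} (G : I -> set X).
Implicit Types U V : {set I}.

Lemma realize_set0 : realize G finset.set0 = set0.
Proof. by apply/seteqP; split => // x [i /=]; rewrite inE. Qed.

Lemma realize_setU U V : realize G (U :|: V)%SET = realize G U `|` realize G V.
Proof.
apply/seteqP; split => x.
  by move=> [i /=]; rewrite inE => /orP[iU|iV] ix; [left|right]; exists i.
by move=> [] [i /= iU ix]; exists i => //=; rewrite inE iU ?orbT.
Qed.

End Realization.

Lemma finite_set_indexed (T : eqType) (S : set T) : finite_set S ->
  exists (J : finType) (a : J -> T),
    (forall j, S (a j)) /\ (forall x, S x -> exists j, x = a j).
Proof.
move=> /finite_seqP[s ->]; exists 'I_(size s), (fun j => tnth (in_tuple s) j).
split=> [j|x]; first exact: mem_tnth.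
by rewrite -[s]/(tval (in_tuple s)) => /tnthP.
Qed.

Section LabelLift.
Context {X : Type} {I : finType} (G : I -> set X).
Hypothesis G_cover : \bigcup_i G i = setT.
Variables (L : lattice_on (set X)) (S : set (set X)).
Hypothesis S_sub : is_sublattice S L.
Variable O : set X -> set X.
Hypotheses (O_bot : O (lbot L) = set0) (O_top : O (ltop L) = setT).
Hypothesis O_join : forall a b, S a -> S b -> O (ljoin L a b) = O a `|` O b.
Hypothesis O_meet : forall a b, S a -> S b -> O (lmeet L a b) = O a `&` O b.
Variable z : I -> X.

Definition label_set (a : set X) : {set I} := [set i | `[< O a (z i) >]]%SET.

Lemma label_setP a i : reflect (O a (z i)) (i \in label_set a).
Proof. by rewrite inE; exact: asboolP. Qed.

(** Preimages under [z] respect the lattice operations, and injectivity follows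
    from the lifting property.  If a point lies in a cell of [label_set a] and
    in a cell of [label_set b], then by comparability the label of one of these
    two cells lies in both [O a] and [O b]; realizations are thus closed under
    intersection. *)
Lemma label_lift (hc : set {set I}) (nc : set (set X)) (lim : set X -> set X) :
  (forall i j x, G i x -> G j x ->
     (forall a, S a -> O a (z i) -> O a (z j)) \/
     (forall a, S a -> O a (z j) -> O a (z i))) ->
  (forall a, S a -> [/\ hc (label_set a), lim (realize G (label_set a)) = a &
                     nc (realize G (label_set a))]) ->
  let H := LatticeOn hc (@finset.setU I) (@finset.setI I)
    finset.set0 [set: I]%SET in
  let N := LatticeOn nc setU setI set0 setT in
  [/\ lattice_mono (restrict_lattice S L) H label_set,
      is_lift (restrict_lattice S L) H
        id (fun U => lim (realize G U)) label_set &
      is_sublattice ((fun a => realize G (label_set a)) @` S) N].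
Proof.
move=> z_cmp lP H N; have [SL S0 S1 SU SI] := S_sub.
have lU a b : S a -> S b ->
    label_set (ljoin L a b) = (label_set a :|: label_set b)%SET.
  move=> Sa Sb; apply/finset.setP => i; rewrite finset.in_setU.
  apply/label_setP/orP.
    by rewrite O_join// => -[?|?]; [left|right]; apply/label_setP.
  by rewrite O_join// => -[/label_setP|/label_setP]; [left|right].
have lI a b : S a -> S b ->
    label_set (lmeet L a b) = (label_set a :&: label_set b)%SET.
  move=> Sa Sb; apply/finset.setP => i; rewrite finset.in_setI.
  apply/label_setP/andP.
    by rewrite O_meet// => -[? ?]; split; apply/label_setP.
  by rewrite O_meet// => -[/label_setP ? /label_setP].
have l0 : label_set (lbot L) = finset.set0.
  apply/finset.setP => i; rewrite [RHS]inE.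
  by apply/negbTE/negP => /label_setP; rewrite O_bot.
have l1 : label_set (ltop L) = [set: I]%SET.
  by apply/finset.setP => i; rewrite [RHS]inE; apply/label_setP; rewrite O_top.
have l_hom : lattice_hom (restrict_lattice S L) H label_set.
  by split => //= a Sa; case: (lP a Sa).
have lim_l a : S a -> lim (realize G (label_set a)) = a by move=> /lP[].
split.
- split => // a b /set_mem Sa /set_mem Sb ab.
  by rewrite -(lim_l a Sa) ab lim_l.
- by split => // a Sa; rewrite lim_l.
- split => /=.
  + by move=> _ [a Sa <-]; case: (lP a Sa).
  + by exists (lbot L) => //; rewrite l0 realize_set0.
  + exists (ltop L) => //; rewrite l1 -G_cover.
    by apply/seteqP; split => x [i _ ix]; exists i => //=; rewrite inE.
  + move=> _ _ [a Sa <-] [b Sb <-]; exists (ljoin L a b); first exact: SU.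
    by rewrite lU// realize_setU.
  + move=> _ _ [a Sa <-] [b Sb <-]; exists (lmeet L a b); first exact: SI.
    rewrite lI//; apply/seteqP; split => x.
      by move=> [i /=]; rewrite inE => /andP[? ?] ?; split; exists i.
    move=> [[i /= ia ix] [j /= jb jx]].
    case: (z_cmp i j x ix jx) => [ij|ji].
      exists j => //=; rewrite inE jb andbT; apply/label_setP; apply: ij => //.
      exact/label_setP.
    exists i => //=; rewrite inE ia /=; apply/label_setP; apply: ji => //.
    exact/label_setP.
Qed.

End LabelLift.

(** * Convergent sequences of outer approximations *)

Section Grids.
Context {R : realType} {X : metricType R} (f : X -> X) (I : nat -> finType)
  (G : forall n, I n -> set X) (F : forall n, I n -> {set I n}).
Arguments G : clear implicits.
Arguments F : clear implicits.
Hypotheses (X_compact : compact [set: X]) (f_cont : continuous f)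
  (G_grid : forall n, grid (G n)) (F_cvg : convergent f G F).
Implicit Types (e r : R) (A K : set X).

Lemma cell_nonempty n i : G n i !=set0.
Proof. by have [+ _ _ _] := G_grid n; exact. Qed.

Lemma cells_small e : 0 < e ->
  \forall n \near \oo, forall i x y, G n i x -> G n i y -> mdist x y < e.
Proof.
move=> e0; have [/cvgr_lt/(_ e e0) + _] := F_cvg.
apply: filterS => n dn i x y ix iy; apply: le_lt_trans dn.
apply: (@le_trans _ _ (diam (G n i))); last exact: le_bigmax.
apply: ub_le_sup; last by exists (x, y).
have [M MP] := compact_mdist_bounded X_compact x.
exists (M + M) => _ [[p q] /= _ <-].
have := metric_triangle p x q; rewrite (metric_sym p x).
by have := MP p; have := MP q; lra.
Qed.

(** As [F n] is contained in the [rho n]-minimal map, an arrow of [F n] is an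
    orbit segment of length one, up to [rho n], the diameters of the cells and
    the modulus of continuity of [f]. *)
Lemma one_step_close e : 0 < e ->
  \forall n \near \oo, forall i j x y, j \in F n i -> G n i x -> G n j y ->
    mdist (f x) y < e.
Proof.
move=> e0; have e30 : 0 < e / 3 by rewrite divr_gt0.
have [r r0 rf] := compact_uniform_continuity X_compact f_cont e30.
have [_ [rho [rho0 /cvgr_lt/(_ _ e30) rho_lt Frho]]] := F_cvg.
near=> n => i j x y ij ix jy.
have small_r : forall i x y, G n i x -> G n i y -> mdist x y < r.
  by near: n; exact: cells_small.
have small_e : forall i x y, G n i x -> G n i y -> mdist x y < e / 3.
  by near: n; exact: cells_small.
have rho_e : rho n < e / 3 by near: n.
have [_ /fintype.subsetP/(_ _ ij)] := Frho n i.
rewrite inE => /asboolP[w [fw jw]].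
have [x' ix' x'w] : exists2 x', G n i x' & mdist (f x') w < e / 3.
  move: fw; rewrite /metric_nbhd; case: ifP => _ [].
    by move=> x' ix' <-; exists x' => //; rewrite mdistxx.
  by move=> _ [x' ix' <-] x'w; exists x' => //; exact: lt_trans x'w rho_e.
have := metric_triangle (f x) (f x') y; have := metric_triangle (f x') w y.
by have := rf _ _ (small_r _ _ _ ix ix'); have := small_e _ _ _ jw jy; lra.
Unshelve. all: by end_near. Qed.

(** The length [k] is fixed while [n] grows, so the one-step errors can be
    absorbed by the continuity of [f]. *)
Lemma shadow e k : 0 < e ->
  \forall n \near \oo, forall i j x y, j \in mv_pow (F n) k [set i]%SET ->
    G n i x -> G n j y -> mdist (iter k f x) y < e.
Proof.
elim: k e => [|k IH] e e0.
  apply: filterS (cells_small e0) => n ne i j x y; rewrite inE => /eqP ->.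
  exact: ne.
have e20 : 0 < e / 2 by rewrite divr_gt0.
have [r r0 rf] := compact_uniform_continuity X_compact f_cont e20.
apply: filterS2 (IH _ r0) (one_step_close e20) => n nr ne i j x y.
rewrite /mv_pow iterS => /bigcupP[l il lj] ix jy.
have [w lw] := cell_nonempty l.
have := rf _ _ (nr _ _ _ _ il ix lw); have := ne _ _ _ _ lj lw jy.
by rewrite iterS; have := metric_triangle (f (iter k f x)) (f w) y; lra.
Qed.

Lemma shadow_upto e L : 0 < e ->
  \forall n \near \oo, forall k, (k < L)%N -> forall i j x y,
    j \in mv_pow (F n) k [set i]%SET ->
    G n i x -> G n j y -> mdist (iter k f x) y < e.
Proof.
move=> e0; have : \forall n \near \oo, forall k : 'I_L, forall i j x y,
    j \in mv_pow (F n) k [set i]%SET ->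
    G n i x -> G n j y -> mdist (iter k f x) y < e.
  by apply: filter_forall => k; exact: shadow.
by apply: filterS => n ne k kL; exact: (ne (Ordinal kL)).
Qed.

Definition inner_cells n (P : set X) : {set I n} :=
  [set i | `[< G n i `<=` P >]]%SET.

Lemma inner_cellsP n P i : reflect (G n i `<=` P) (i \in inner_cells n P).
Proof. by rewrite inE; exact: asboolP. Qed.

Lemma sub_interior_realize n (V : {set I n}) A e : 0 < e ->
  (forall i x a, G n i x -> A a -> mdist a x < e -> i \in V) ->
  A `<=` (realize (G n) V)° /\
  (forall a x, A a -> mdist a x < e -> realize (G n) V x).
Proof.
move=> e0 AV; have cov a x : A a -> mdist a x < e -> realize (G n) V x.
  move=> Aa ax; have [_ _ + _] := G_grid n => /seteqP[_ /(_ x Logic.I)[i _ ix]].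
  by exists i => //=; exact: (AV _ x a).
split=> // a Aa; apply/nbhs_mdist; exists e => // x; exact: cov.
Qed.

(** [V] may be any cell set whose realization contains the [e]-thickening of [A]
    and is at distance at least [d] from the dual repeller; this freedom is what
    the labels need.  The proof takes for the trapping bounds the points [t]-far
    from the dual repeller and the points [t]-close to [A]. *)
Lemma attractor_cells A e d : attractor f A -> 0 < e -> 0 < d ->
  \forall n \near \oo, forall V : {set I n},
    (forall i x y, i \in V -> G n i x -> ~ basin f A y -> d <= mdist x y) ->
    (forall i x a, G n i x -> A a -> mdist a x < e -> i \in V) ->
    [/\ mv_omega (F n) V `<=` [set` V],
        omega_lim f (realize (G n) V) = A &
        attracting_nbhd f (realize (G n) V)].
Proof.
move=> Aa e0 d0; have [U UU AE] := Aa.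
have Ac : closed A by rewrite AE; exact: omega_lim_closed.
have [s s0 sP] := closed_sub_open_uniform X_compact Ac
  (basin_open X_compact f_cont Aa) (attractor_sub_basin Aa).
(* [t <= s / 2] separates the [t]-thickenings of [A] and of its dual repeller. *)
pose t := Num.min e (Num.min d (s / 2)).
have t0 : 0 < t by rewrite !lt_min e0 d0 divr_gt0.
have [te td ts] : [/\ t <= e, t <= d & t <= s / 2].
  by rewrite /t !ge_min !lexx !orbT.
pose C := [set x | forall y, ~ basin f A y -> t <= mdist x y].
have EC x : thickening A t x -> C x.
  move=> [a Aa']; move=> ax y ny; rewrite leNgt; apply/negP => xy.
  apply: ny; apply: (sP a) => //.
  by have := metric_triangle a x y; lra.
have to_A r : 0 < r -> exists N, forall k, (N <= k)%N -> forall x, C x -> 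
    thickening A r (iter k f x).
  move=> r0.
  have [N NP] := uniform_attraction X_compact f_cont Aa (@open_interior _ _)
    (sub_interior_thickening r0) t0.
  by exists N => k Nk x Cx; apply: interior_subset; exact: NP.
have [N NP] := to_A _ (divr_gt0 t0 (ltr0n R 2)).
have t20 : 0 < t / 2 by rewrite divr_gt0.
apply: filterS (shadow_upto (N.+1 + N.+1) t20) => n close V VC AV.
have [AVi AV'] := sub_interior_realize e0 AV.
have VA : omega_lim f (realize (G n) V) = A.
  apply/seteqP; split.
    move=> x Vx; apply: contrapT => nAx.
    have [r r0 rP] := closed_far Ac nAx.
    have [M MP] := to_A _ (divr_gt0 r0 (ltr0n R 2)).
    have nx : nbhs x [set y | mdist x y < r / 2].
      by apply/nbhs_mdist; exists (r / 2) => //; rewrite divr_gt0.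
    have [y [[k /= Mk [v [i /= iV iv] <-]] kx]] := Vx M Logic.I _ nx.
    have Cv : C v by move=> w nw; apply: le_trans td _; exact: (VC i).
    have [a Aa' av] := MP k Mk v Cv.
    apply: (rP a Aa'); have := metric_triangle x (iter k f v) a.
    by rewrite (metric_sym (iter k f v) a); lra.
  have [|M MP] := limsup_sub_open X_compact (@open_interior _ (thickening A e))
    (_ : omega_lim f U `<=` (thickening A e)°).
    by rewrite -AE; exact: sub_interior_thickening.
  (* [A] is the limit set of [U], and [f^M] maps [U] into the realization of
     [V]. *)
  rewrite {1}AE; apply: (@omega_lim_sub _ _ M) => x /(MP M (leqnn _)).
  by move=> /interior_subset[a Aa']; exact: AV'.
split => //; last by rewrite /attracting_nbhd VA.
apply: (@mv_limit_trapped _ _ N.+1 (inner_cells n C)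
  (inner_cells n (thickening A t))) => //.
- apply/fintype.subsetP => i /inner_cellsP iE.
  have [x ix] := cell_nonempty i.
  have [a Aa' ax] := iE _ ix.
  by apply: (AV i x a) => //; lra.
- apply/fintype.subsetP => i iV; apply/inner_cellsP => x ix y ny.
  by apply: le_trans td _; exact: (VC i).
move=> k /andP[Nk kN].
apply/fintype.subsetP => j /mv_powP[i /inner_cellsP iC ij].
apply/inner_cellsP => y jy.
have [x ix] := cell_nonempty i.
have [a Aa' ax] := NP k (ltnW Nk) x (iC x ix).
exists a => //.
have := close k kN i j x y ij ix jy.
by have := metric_triangle a (iter k f x) y; lra.
Qed.

(** A backward orbit of [F n] from a cell [i] near [B] to a cell [j] is a forward
    orbit from [j] to [i], so that [f^k] maps [j] near [B], hence into the
    repelling neighborhood [U]; the inverse images of [U] shrink to [B]. *)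
Lemma repeller_cells B : repeller f B -> exists2 s, 0 < s &
  forall d, 0 < d -> \forall n \near \oo, forall V : {set I n},
    (forall i x, i \in V -> G n i x -> exists2 b, B b & mdist b x < s) ->
    (forall i x b, G n i x -> B b -> mdist b x < d -> i \in V) ->
    [/\ mv_alpha (F n) V `<=` [set` V],
        alpha_lim f (realize (G n) V) = B &
        repelling_nbhd f (realize (G n) V)].
Proof.
move=> [U UU BE].
have Bc : closed B by rewrite BE; exact: alpha_lim_closed.
have BU : B `<=` U° by rewrite BE.
have [s s0 sP] := closed_sub_open_uniform X_compact Bc (@open_interior _ U) BU.
have s20 : 0 < s / 2 by rewrite divr_gt0.
(* The other half of [s] is left for the error in shadowing. *)
exists (s / 2) => // d d0.
pose t := Num.min d (s / 2).
have t0 : 0 < t by rewrite !lt_min d0.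
have [td ts] : t <= d /\ t <= s / 2 by rewrite /t !ge_min !lexx !orbT.
have [|N NP] := limsup_sub_open X_compact (@open_interior _ (thickening B t))
  (_ : alpha_lim f U `<=` (thickening B t)°).
  by rewrite -BE; exact: sub_interior_thickening.
apply: filterS (shadow_upto (N.+1 + N.+1) s20) => n close V VB BV.
have [BVi BV'] := sub_interior_realize d0 BV.
have VE : alpha_lim f (realize (G n) V) = B.
  apply/seteqP; split; rewrite BE.
    apply: (@alpha_lim_sub _ _ 0) => x [i /= iV ix].
    have [b Bb bx] := VB i x iV ix.
    by apply: interior_subset; apply: (sP b) => //; lra.
  apply: (@alpha_lim_sub _ _ N) => x /(NP N (leqnn _)) /interior_subset[b Bb bx].
  by apply: (BV' b) => //; lra.
split => //; last by rewrite /repelling_nbhd VE.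
pose C := inner_cells n (thickening B (s / 2)).
apply: (@mv_limit_trapped _ _ N.+1 C (inner_cells n (thickening B t))) => //.
- apply/fintype.subsetP => i /inner_cellsP iE.
  have [x ix] := cell_nonempty i.
  have [b Bb bx] := iE _ ix.
  by apply: (BV i x b) => //; lra.
- apply/fintype.subsetP => i iV; apply/inner_cellsP => x ix.
  by have [b Bb bx] := VB i x iV ix; exists b.
move=> k /andP[Nk kN]; apply/fintype.subsetP => j /mv_powP[i /inner_cellsP iC].
rewrite mem_mv_pow_inverse => ji; apply/inner_cellsP => y jy.
have [x ix] := cell_nonempty i.
apply: interior_subset; apply: (NP k (ltnW Nk)) => /=.
have [b Bb bx] := iC x ix.
apply: interior_subset; apply: (sP b) => //.
have := close k kN j i y x ji jy ix; have := metric_triangle b x (iter k f y).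
by rewrite (metric_sym x); lra.
Qed.

(** A cell gets the label of a point chosen in it; half of each bound on labels
    pays for the diameter of the cell. *)
Lemma cell_labels (J : finType) (K : J -> set X) e :
  (forall j, closed (K j)) -> 0 < e ->
  exists2 r, 0 < r & \forall n \near \oo, exists z : I n -> X,
    [/\ forall i x, G n i x -> mdist x (z i) < e,
        forall i x j y, G n i x -> K j y -> mdist x y < r -> K j (z i) &
        forall i i' x, G n i x -> G n i' x ->
          (forall j, K j (z i) -> K j (z i')) \/
          (forall j, K j (z i') -> K j (z i))].
Proof.
move=> Kc e0; have e20 : 0 < e / 2 by rewrite divr_gt0.
have [r r0 [z [z_close z_near z_cmp]]] := comparable_labels X_compact Kc e20.
have r20 : 0 < r / 2 by rewrite divr_gt0.
exists (r / 2) => //.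
apply: filterS2 (cells_small e20) (cells_small r20) => n small_e small_r.
have /choice[c cP] : forall i, exists x, G n i x.
  by move=> i; exact: cell_nonempty.
exists (fun i => z (c i)); split.
- move=> i x ix; have := small_e _ _ _ ix (cP i); have := z_close (c i).
  by have := metric_triangle x (c i) (z (c i)); lra.
- move=> i x j y ix Ky xy; apply: z_near; exists y => //.
  have := small_r _ _ _ (cP i) ix; have := metric_triangle (c i) x y; lra.
- move=> i i' x ix i'x; apply: z_cmp.
  have := small_r _ _ _ (cP i) ix; have := small_r _ _ _ i'x (cP i').
  by have := metric_triangle (c i) x (c i'); lra.
Qed.

Lemma attractor_lattice_lift (S : set (set X)) :
  finite_set S -> is_sublattice S (Att f) ->
  \forall n \near \oo, exists l : set X -> {set I n},
      [/\ lattice_mono (restrict_lattice S (Att f)) (ASet (F n)) l,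
          is_lift (restrict_lattice S (Att f)) (ASet (F n))
            id (fun U => omega_lim f (realize (G n) U)) l &
          is_sublattice ((fun a => realize (G n) (l a)) @` S) (ANbhd f)].
Proof.
move=> /finite_set_indexed[J [a [aS Sa]]] S_sub; have [SA _ _ _ SI] := S_sub.
have a_att j : attractor f (a j) by exact: SA.
have a_closed j : closed (a j).
  by have [U _ ->] := a_att j; exact: omega_lim_closed.
pose K j := ~` basin f (a j).
have Kc j : closed (K j).
  exact: open_closedC (basin_open X_compact f_cont (a_att j)).
have /choice[rho rhoP] : forall j, exists r, 0 < r /\
    forall x y, a j x -> mdist x y < r -> basin f (a j) y.
  move=> j; have [r r0 rP] := closed_sub_open_uniform X_compact (a_closed j)
    (basin_open X_compact f_cont (a_att j)) (attractor_sub_basin (a_att j)).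
  by exists r.
pose r := \big[Num.min/1]_j rho j.
have r0 : 0 < r by apply: lt_bigmin => // j _; case: (rhoP j).
have r20 : 0 < r / 2 by rewrite divr_gt0.
have [d d0 labels] := cell_labels Kc r20.
have all_cells := filter_forall _ (fun j => attractor_cells (a_att j) r20 d0).
apply: filterS2 labels (all_cells _) => n [z [z_close z_near z_cmp]] cells.
have [_ _ cover _] := G_grid n.
exists (label_set (basin f) z).
apply: (@label_lift _ _ _ cover _ _ S_sub (basin f) _ _ _ _ z
  [set U | mv_omega (F n) U `<=` [set` U]] (attracting_nbhd f) (omega_lim f)).
- exact: basin_set0.
- exact: basin_omega_setT.
- move=> A B /SA ? /SA ?; exact: basin_setU.
- move=> A B A_ B_; apply: basin_meet => //; [exact: SA|exact: SA|].
  exact: SA (SI _ _ A_ B_).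
- move=> i i' x ix i'x.
  case: (z_cmp i i' x ix i'x) => H; [right|left] => A /Sa[j ->].
    by move=> ji'; apply: contrapT => /H.
  by move=> ji; apply: contrapT => /H.
- move=> A /Sa[j ->]; apply: cells.
    move=> i x y /label_setP iA ix nAy; rewrite leNgt; apply/negP => xy.
    exact: (z_near _ _ j _ ix nAy xy).
  move=> i x y ix ay yx; apply/label_setP.
  have [_ /(_ y (z i) ay)] := rhoP j; apply.
  have : r <= rho j by exact: bigmin_le.
  by have := z_close i x ix; have := metric_triangle y x (z i); lra.
Qed.

Lemma repeller_lattice_lift (S : set (set X)) :
  finite_set S -> is_sublattice S (Rep f) ->
  \forall n \near \oo, exists l : set X -> {set I n},
      [/\ lattice_mono (restrict_lattice S (Rep f)) (RSet (F n)) l,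
          is_lift (restrict_lattice S (Rep f)) (RSet (F n))
            id (fun U => alpha_lim f (realize (G n) U)) l &
          is_sublattice ((fun a => realize (G n) (l a)) @` S) (RNbhd f)].
Proof.
move=> /finite_set_indexed[J [b [bS Sb]]] S_sub; have [SB _ _ _ _] := S_sub.
have b_rep j : repeller f (b j) by exact: SB.
have b_closed j : closed (b j).
  by have [U _ ->] := b_rep j; exact: alpha_lim_closed.
have /choice[rho rhoP] : forall j, exists s, 0 < s /\ forall d, 0 < d ->
    \forall n \near \oo, forall V : {set I n},
    (forall i x, i \in V -> G n i x -> exists2 y, b j y & mdist y x < s) ->
    (forall i x y, G n i x -> b j y -> mdist y x < d -> i \in V) ->
    [/\ mv_alpha (F n) V `<=` [set` V],
        alpha_lim f (realize (G n) V) = b j &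
        repelling_nbhd f (realize (G n) V)].
  by move=> j; have [r r0 rP] := repeller_cells (b_rep j); exists r.
pose r := \big[Num.min/1]_j rho j.
have r0 : 0 < r by apply: lt_bigmin => // j _; case: (rhoP j).
have [d d0 labels] := cell_labels b_closed r0.
have all_cells := filter_forall _ (fun j => (rhoP j).2 d d0).
apply: filterS2 labels (all_cells _) => n [z [z_close z_near z_cmp]] cells.
have [_ _ cover _] := G_grid n.
exists (label_set id z).
apply: (@label_lift _ _ _ cover _ _ S_sub id _ _ _ _ z
  [set U | mv_alpha (F n) U `<=` [set` U]] (repelling_nbhd f)
  (alpha_lim f)) => //.
- move=> i i' x ix i'x.
  by case: (z_cmp i i' x ix i'x) => H; [left|right] => A /Sb[j ->]; exact: H.
- move=> A /Sb[j ->]; apply: cells.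
    move=> i x /label_setP iA ix; exists (z i) => //.
    rewrite metric_sym; apply: lt_le_trans (z_close i x ix) _; exact: bigmin_le.
  move=> i x y ix ay yx; apply/label_setP; apply: (z_near _ _ j _ ix ay).
  by rewrite metric_sym.
Qed.

End Grids.

Theorem theorem4p21 (R : realType) (X : metricType R) (f : X -> X)
    (I : nat -> finType) (G : forall n, I n -> set X)
    (F : forall n, I n -> {set I n})
    (X_compact : compact [set: X]) (f_cont : continuous f)
    (G_grid : forall n, grid (G n))
    (F_outer : forall n, outer_approximation f (G n) (F n))
    (F_cvg : convergent f G F) :
  (forall A : set (set X), finite_set A -> is_sublattice A (Att f) ->
    exists nA : nat, forall n : nat, (nA <= n)%N ->
    exists l : set X -> {set I n},
      [/\ lattice_mono (restrict_lattice A (Att f)) (ASet (F n)) l,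
          is_lift (restrict_lattice A (Att f)) (ASet (F n))
            id (fun U => omega_lim f (realize (G n) U)) l &
          is_sublattice ((fun a => realize (G n) (l a)) @` A) (ANbhd f)])
  /\
  (forall B : set (set X), finite_set B -> is_sublattice B (Rep f) ->
    exists nB : nat, forall n : nat, (nB <= n)%N ->
    exists l : set X -> {set I n},
      [/\ lattice_mono (restrict_lattice B (Rep f)) (RSet (F n)) l,
          is_lift (restrict_lattice B (Rep f)) (RSet (F n))
            id (fun U => alpha_lim f (realize (G n) U)) l &
          is_sublattice ((fun b => realize (G n) (l b)) @` B) (RNbhd f)]).
Proof.
split => [A Afin Asub|B Bfin Bsub].
  have [nA _ nAP] :=
    attractor_lattice_lift X_compact f_cont G_grid F_cvg Afin Asub.
  by exists nA.
have [nB _ nBP] :=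
  repeller_lattice_lift X_compact f_cont G_grid F_cvg Bfin Bsub.
by exists nB.
Qed.
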